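(* Let $n\ge 2$ and $m\ge 1$ be integers. If $m\ge 2$, then $\chi_{la}(f_n\circ O_m)\ge m(2n+1)+3$. If $m=1$, then $\chi_{la}(f_n\circ O_1)\ge m(2n+1)+2 = 2n+3$.
   Context: All graphs are finite, undirected, without loops or multiple edges. The friendship graph $f_n$ ($n\ge 2$) is the graph consisting of $n$ triangles sharing exactly one common vertex (so it has $2n+1$ vertices and $3n$ edges). $O_m$ is the null graph (edgeless graph) of order $m\ge 1$. The corona product $G\circ H$ is the graph obtained by taking one copy of $G$ and $|V(G)|$ disjoint copies of $H$, and joining the $i$-th vertex of $G$ to every vertex of the $i$-th copy of $H$, for $1\le i\le |V(G)|$; thus $G\circ O_m$ is $G$ with $m$ pendant vertices attached to each vertex of $G$. For a connected graph $G=(V,E)$ with $q=|E|$ and a bijection $f:E\to\{1,2,\dots,q\}$, the weight of a vertex $u$ is $w(u)=\sum_{e\in E(u)} f(e)$, where $E(u)$ is the set of edges incident to $u$. The bijection $f$ is a local antimagic labeling of $G$ if $w(u)\ne w(v)$ for every two adjacent vertices $u,v$. Assigning the color $w(u)$ to each vertex $u$ then gives a proper vertex coloring of $G$, whose number of colors is the number of distinct values of $w$. The local antimagic chromatic number $\chi_{la}(G)$ is the minimum number of distinct colors $|\{w(u): u\in V\}|$ over all local antimagic labelings $f$ of $G$. *)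

(* Defs.v *)
From mathcomp Require Import all_boot.

Set Implicit Arguments.
Unset Strict Implicit.
Unset Printing Implicit Defensive.

Record sgraph := SGraph {
  vertex :> finType;
  adj : rel vertex;
  adj_sym : symmetric adj;
  adj_irrefl : irreflexive adj
}.

Definition edges (G : sgraph) : {set {set G}} :=
  [set e | [exists x : G, exists y : G, adj x y && (e == [set x; y])]].

(* The centre is [None]; the i-th triangle has vertices [None],
   [Some (i, false)] and [Some (i, true)]. *)
Section Friendship.
Variable n : nat.

Definition friendship_adj : rel (option ('I_n * bool)) := fun u v =>
  match u, v with
  | None, Some _ | Some _, None => true
  | Some (i, a), Some (j, b) => (i == j) && (a != b)
  | None, None => false
  end.

Lemma friendship_adj_sym : symmetric friendship_adj.
Proof. by move=> [[i a]|] [[j b]|] //=; rewrite eq_sym (eq_sym a). Qed.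

Lemma friendship_adj_irrefl : irreflexive friendship_adj.
Proof. by move=> [[i a]|] //=; rewrite !eqxx. Qed.

Definition friendship := SGraph friendship_adj_sym friendship_adj_irrefl.
End Friendship.

Section NullGraph.
Variable m : nat.

Definition null_adj : rel 'I_m := fun _ _ => false.

Lemma null_adj_sym : symmetric null_adj. Proof. by []. Qed.
Lemma null_adj_irrefl : irreflexive null_adj. Proof. by []. Qed.

Definition null_graph := SGraph null_adj_sym null_adj_irrefl.
End NullGraph.

(* [inl x] is the vertex x of G; [inr (x, a)] is the vertex a in the copy of H
   attached to x. *)
Section Corona.
Variables G H : sgraph.

Definition corona_adj : rel (G + G * H)%type := fun u v =>
  match u, v with
  | inl x, inl y => adj x y
  | inl x, inr (y, _) | inr (y, _), inl x => x == y
  | inr (x, a), inr (y, b) => (x == y) && adj a b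
  end.

Lemma corona_adj_sym : symmetric corona_adj.
Proof.
by move=> [x|[x a]] [y|[y b]] //=; rewrite adj_sym // (eq_sym x).
Qed.

Lemma corona_adj_irrefl : irreflexive corona_adj.
Proof. by move=> [x|[x a]] /=; rewrite adj_irrefl ?andbF. Qed.

Definition corona := SGraph corona_adj_sym corona_adj_irrefl.
End Corona.

Section LocalAntimagic.
Variable G : sgraph.

(* Only the values on [edges G] matter; {1, ..., q} is 'I_q.+1 without 0. *)
Definition labeling := {ffun {set G} -> 'I_#|edges G|.+1}.

Definition edge_bijection (f : labeling) : bool :=
  dinjectiveb f (mem (edges G)) && (f @: edges G == [set~ ord0]).

Definition weight (f : labeling) (u : G) : nat :=
  \sum_(e in edges G | u \in e) f e.

Definition local_antimagic (f : labeling) : bool :=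
  edge_bijection f &&
  [forall u : G, forall v : G, adj u v ==> (weight f u != weight f v)].

Definition num_colors (f : labeling) : nat :=
  size (undup [seq weight f u | u : G]).

(* The value is 0 if G has no local antimagic labeling, so a positive lower
   bound on [chi_la] in particular asserts that a labeling exists. *)
Definition chi_la : nat :=
  if [pick f | local_antimagic f] is Some f0
  then num_colors [arg min_(f < f0 | local_antimagic f) num_colors f]
  else 0.

Lemma chi_laP (f0 : labeling) : local_antimagic f0 ->
  (exists2 f, local_antimagic f & num_colors f = chi_la) /\
  (forall f, local_antimagic f -> chi_la <= num_colors f).
Proof.
move=> laf0; rewrite /chi_la; case: pickP => [f1 laf1|/(_ f0)]; last first.
  by rewrite laf0.
by case: arg_minnP => // f laf minf; split; first by exists f.
Qed.
End LocalAntimagic.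

(* Main.v *)
(* Every weight of a leaf is the label of a pendant edge, hence at most the
   number q of edges, and these m(2n+1) weights are distinct.  The weight of the
   centre, a sum of 2n+m distinct labels, exceeds q.  If m >= 2 and every
   triangle had a non-central vertex coloured like a leaf, then n(m+2) distinct
   labels would have total at most nq, which is too small; so some triangle has
   three colours not used on leaves.  If m = 1, the 2n non-central triangle
   vertices cannot all have weight at most q, because 5n distinct labels
   contribute to their weights.

   As [chi_la] is 0 for a graph without local antimagic labelings, one is also
   needed: give the n edges avoiding the centre the smallest labels, then
   label the 2n spokes, then the pendant edges vertex by vertex, ending with
   the centre. *)
Require Import Defs.
From mathcomp Require Import all_boot.
From mathcomp Require Import zify.

Set Implicit Arguments.
Unset Strict Implicit.
Unset Printing Implicit Defensive.

(** * Sums of distinct positive integers *)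

(** Induction on the cardinality, removing an element of largest value. That value is at least
    [#|A|], because the values on [A] are distinct members of {1, ..., g x}. The doubled form avoids
    division by 2. *)
Lemma leq_sum_inj_pos_in (T : finType) (A : {set T}) (g : T -> nat) :
    {in A &, injective g} -> {in A, forall x, 0 < g x} ->
  #|A| * #|A|.+1 <= 2 * \sum_(x in A) g x.
Proof.
move: {2}#|A| (erefl #|A|) => k; elim: k A => [|k IHk] A cardA g_inj g_gt0.
  by rewrite cardA.
have /card_gt0P[x0 Ax0] : 0 < #|A| by rewrite cardA.
case: (@arg_maxnP _ x0 (mem A) g Ax0) => x; rewrite /= => Ax g_max.
have leA : #|A| <= g x.
  rewrite cardE -(size_map g) -(size_iota 1 (g x)); apply: uniq_leq_size.
    rewrite map_inj_in_uniq ?enum_uniq // => y z.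
    by rewrite !mem_enum; apply: g_inj.
  move=> l /mapP[y]; rewrite mem_enum => Ay ->.
  by rewrite mem_iota g_gt0 //= add1n ltnS; apply: g_max.
have cardA' : #|A :\ x| = k by move: cardA; rewrite (cardsD1 x) Ax => -[].
have subA y : y \in A :\ x -> y \in A by case/setD1P.
have := IHk _ cardA' (sub_in2 subA g_inj) (sub_in1 subA g_gt0).
rewrite (big_setD1 x Ax) /= cardA' cardA in leA *; nia.
Qed.

Lemma leq_sum_inj_pos (T : finType) (g : T -> nat) :
    injective g -> (forall x, 0 < g x) ->
  #|T| * #|T|.+1 <= 2 * \sum_x g x.
Proof.
move=> g_inj g_gt0; rewrite -cardsT.
have -> : \sum_x g x = \sum_(x in [set: T]) g x.
  by apply: eq_bigl => x; rewrite inE.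
by apply: leq_sum_inj_pos_in => // x y _ _; apply: g_inj.
Qed.

(** * The edges of the corona, indexed by type of edge *)

Section FriendshipCorona.
Variables n m : nat.

Let G := corona (friendship n) (null_graph m).

Definition hub : G := inl None.
Definition rim (p : 'I_n * bool) : G := inl (Some p).
Definition leaf (v : option ('I_n * bool)) (k : 'I_m) : G := inr (v, k).

(** The summands stand for the triangle edges avoiding the centre, the spokes and the pendant edges,
    so that a sum over edges splits with [big_sumType]. *)
Definition edge_index : finType :=
  ('I_n + 'I_n * bool + option ('I_n * bool) * 'I_m)%type.

Definition base (i : 'I_n) : edge_index := inl (inl i).
Definition spoke (p : 'I_n * bool) : edge_index := inl (inr p).
Definition pendant (v : option ('I_n * bool)) (k : 'I_m) : edge_index :=
  inr (v, k).

Definition edge_of (x : edge_index) : {set G} :=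
  match x with
  | inl (inl i) => [set rim (i, false); rim (i, true)]
  | inl (inr p) => [set hub; rim p]
  | inr (v, k) => [set inl v; leaf v k]
  end.

Lemma card_edge_index : #|edge_index| = 3 * n + m * (2 * n + 1).
Proof.
rewrite /edge_index !card_sum !card_prod card_option card_prod !card_ord.
rewrite card_bool; lia.
Qed.

Lemma edge_of_inj : injective edge_of.
Proof.
move=> [[i|p]|[v k]] [[j|r]|[w l]] /setP eqE.
- have := eqE (rim (i, false)).
  by rewrite !inE /= eqxx /= => /esym/orP[]/eqP[->].
- by have := eqE hub; rewrite !inE.
- by have := eqE (leaf w l); rewrite !inE eqxx orbT.
- by have := eqE hub; rewrite !inE.
- by have := eqE (rim p); rewrite !inE eqxx orbT => /esym/eqP[->].
- by have := eqE (leaf w l); rewrite !inE eqxx orbT.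
- by have := eqE (leaf v k); rewrite !inE eqxx orbT.
- by have := eqE (leaf v k); rewrite !inE eqxx orbT.
- by have := eqE (leaf v k); rewrite !inE eqxx orbT /= => /esym/eqP[-> ->].
Qed.

Lemma edges_corona : edges G = edge_of @: setT.
Proof.
apply/setP => e; apply/idP/imsetP.
  rewrite inE => /existsP[x /existsP[y /andP[]]].
  case: x y => [[[i a]|]|[v k]] [[[j b]|]|[w l]] //=.
  - move=> /andP[/eqP<-] ab /eqP->; exists (base i); first exact: in_setT.
    by case: a b ab => [] [] // _; rewrite setUC.
  - by move=> _ /eqP->; exists (spoke (i, a)); rewrite ?in_setT // setUC.
  - by move=> /eqP<- /eqP->; exists (pendant (Some (i, a)) l); rewrite ?in_setT.
  - by move=> _ /eqP->; exists (spoke (j, b)); rewrite ?in_setT.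
  - by move=> /eqP<- /eqP->; exists (pendant None l); rewrite ?in_setT.
  - by move=> /eqP<- /eqP->; exists (pendant (Some (j, b)) k); 
      rewrite ?in_setT // setUC.
  - by move=> /eqP<- /eqP->; exists (pendant None k); rewrite ?in_setT // setUC.
  - by rewrite /null_adj andbF.
case=> -[[i|p]|[v k]] _ ->; rewrite inE; apply/existsP.
- exists (rim (i, false)); apply/existsP; exists (rim (i, true)).
  by rewrite /= !eqxx.
- by exists hub; apply/existsP; exists (rim p); rewrite /= !eqxx.
- by exists (inl v); apply/existsP; exists (leaf v k); rewrite /= !eqxx.
Qed.

Lemma edgesP e : reflect (exists x, e = edge_of x) (e \in edges G).
Proof.
rewrite edges_corona; apply: (iffP imsetP) => [[x _ ->]|[x ->]]; by exists x.
Qed.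

Lemma card_edges : #|edges G| = 3 * n + m * (2 * n + 1).
Proof.
rewrite edges_corona card_imset ?cardsT ?card_edge_index //.
exact: edge_of_inj.
Qed.

Section Weights.
Variable f : labeling G.

Let g (x : edge_index) : nat := f (edge_of x).

Lemma weightE u : weight f u = \sum_(x | u \in edge_of x) g x.
Proof.
rewrite /weight (eq_bigl (fun e => (e \in edge_of @: setT) && (u \in e))).
  2: by move=> e; rewrite edges_corona.
rewrite big_mkcondr /=.
rewrite big_imset /=; last by move=> x y _ _; apply: edge_of_inj.
by rewrite [RHS]big_mkcond; apply: eq_bigl => x; rewrite inE.
Qed.

Lemma weight_hub :
  weight f hub = \sum_p g (spoke p) + \sum_k g (pendant None k).
Proof.
rewrite weightE big_sumType big_sumType /=.
rewrite big_pred0 ?add0n; last by move=> i; rewrite !inE.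
congr (_ + _); first by apply: eq_bigl => p; rewrite !inE.
rewrite (reindex_onto (fun k => (None, k)) snd) => [|[[v|] k]]; last by [].
  by apply: eq_bigl => k; rewrite !inE !eqxx.
by rewrite !inE.
Qed.

Lemma weight_rim i b :
  weight f (rim (i, b)) =
  g (base i) + g (spoke (i, b)) + \sum_k g (pendant (Some (i, b)) k).
Proof.
rewrite weightE big_sumType big_sumType /=.
congr (_ + _ + _).
- rewrite (big_pred1 i) // => j; rewrite !inE.
  apply/idP/eqP => [/orP[]/eqP[-> //]|->].
  by case: b; rewrite eqxx ?orbT.
- rewrite (big_pred1 (i, b)) // => p; rewrite !inE /=.
  by rewrite eq_sym.
rewrite (reindex_onto (fun k => (Some (i, b), k)) snd) => [|[v k]].
  by apply: eq_bigl => k; rewrite !inE !eqxx.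
by rewrite !inE /= orbF => /eqP[->].
Qed.

Lemma weight_leaf v k : weight f (leaf v k) = g (pendant v k).
Proof.
rewrite weightE (big_pred1 (pendant v k)) // => -[[i|p]|[w l]].
- by rewrite !inE.
- by rewrite !inE.
- by rewrite !inE /= eq_sym.
Qed.

Hypothesis f_bij : edge_bijection f.

Let q := 3 * n + m * (2 * n + 1).

Lemma label_inj : injective g.
Proof.
move=> x y /val_inj eq_f; apply: edge_of_inj.
case/andP: f_bij => /dinjectiveP f_inj _.
by apply: f_inj => //; rewrite edges_corona imset_f.
Qed.

Lemma label_gt0 x : 0 < g x.
Proof.
have : f (edge_of x) \in f @: edges G.
  by apply: imset_f; rewrite edges_corona imset_f.
by case/andP: f_bij => _ /eqP->; rewrite !inE -val_eqE lt0n.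
Qed.

Lemma label_le x : g x <= q.
Proof. by rewrite /q -card_edges -ltnS; apply: ltn_ord. Qed.

Definition leaf_colors : seq nat :=
  [seq g (pendant vk.1 vk.2) | vk : option ('I_n * bool) * 'I_m].

Lemma leaf_colors_le w : w \in leaf_colors -> w <= q.
Proof. by case/mapP => vk _ ->; apply: label_le. Qed.

(** Leaf weights are labels of distinct pendant edges, hence pairwise distinct. Appended to [zs]
    they form a duplicate-free list of colours that occur. *)
Lemma leq_num_colors (zs : seq nat) :
    uniq zs -> {in zs, forall z, z \notin leaf_colors} ->
    {subset zs <= [seq weight f u | u : G]} ->
  m * (2 * n + 1) + size zs <= num_colors f.
Proof.
move=> zs_uniq zs_new zs_sub.
have -> : m * (2 * n + 1) = size leaf_colors.
  rewrite size_map -cardE card_prod card_option card_prod !card_ord card_bool.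
  lia.
rewrite -size_cat; apply: uniq_leq_size.
  rewrite cat_uniq zs_uniq andbT map_inj_uniq ?enum_uniq /=; last first.
    by move=> [v k] [w l] /label_inj[-> ->].
  by apply/hasPn => z /zs_new.
move=> z; rewrite mem_cat mem_undup => /orP[/mapP[[v k] _ ->]|/zs_sub//].
by apply/mapP; exists (leaf v k); rewrite ?mem_enum ?weight_leaf.
Qed.

Hypothesis n_ge2 : 2 <= n.

(** The hub is incident to 2n+m edges, so twice its weight is at least (2n+m)(2n+m+1), which exceeds
    2q by 4n(n-1) + m(m-1) > 0. *)
Lemma weight_hub_gt : q < weight f hub.
Proof.
pose h (x : ('I_n * bool) + 'I_m) : edge_index :=
  match x with inl p => spoke p | inr k => pendant None k end.
have h_inj : injective h by move=> [p|k] [r|l] //= [->].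
have := leq_sum_inj_pos (inj_comp label_inj h_inj) (fun x => label_gt0 (h x)).
rewrite big_sumType card_sum card_prod card_bool !card_ord /= -weight_hub /q.
nia.
Qed.

(** For m = 1 one has q = 5n+1. Otherwise the 2n rim weights would total at most 2n(5n+1), whereas
    5n distinct labels total at least 5n(5n+1)/2. *)
Lemma exists_nonleaf_color : m = 1 ->
  exists p, weight f (rim p) \notin leaf_colors.
Proof.
move=> m1; apply/existsP; apply: contraLR isT => /existsPn all_leaf.
have sum_le : \sum_p weight f (rim p) <= 2 * n * q.
  have -> : 2 * n * q = \sum_(p : 'I_n * bool) q.
    by rewrite sum_nat_const card_prod card_bool card_ord; lia.
  apply: leq_sum => p _; apply: leaf_colors_le.
  by have := all_leaf p; rewrite negbK.
pose h (x : 'I_n + 'I_n * bool + ('I_n * bool) * 'I_m) : edge_index :=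
  match x with
  | inl (inl i) => base i
  | inl (inr p) => spoke p
  | inr (p, k) => pendant (Some p) k
  end.
have h_inj : injective h.
  by move=> [[i|p]|[p k]] [[j|r]|[r l]] //= [->] // ->.
have := leq_sum_inj_pos (inj_comp label_inj h_inj) (fun x => label_gt0 (h x)).
rewrite !big_sumType !card_sum !card_prod card_bool !card_ord /=.
have : \sum_i g (base i) + \sum_p g (spoke p) +
    \sum_pk g (h (inr pk)) <= \sum_p weight f (rim p).
  rewrite [X in _ <= X](eq_bigr (fun p => g (base p.1) + g (spoke p) +
    \sum_k g (pendant (Some p) k))); last by move=> [i b] _; rewrite weight_rim.
  rewrite !big_split /= pair_bigA /=.
  rewrite leq_add ?leq_add //; last by apply/eq_leq/eq_bigr => -[p k].
  (* Each base edge is counted at both of its ends; one copy is dropped. *)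
  rewrite -(pair_bigA _ (fun i b => g (base i))) /=.
  by apply: leq_sum => i _; rewrite big_bool leq_addr.
rewrite /q in sum_le; move: sum_le.
move: (\sum_p _) (\sum_i _) (\sum_p _) (\sum_pk _) => W A B C.
by rewrite m1; nia.
Qed.

(** Otherwise one leaf-coloured rim vertex per triangle gives n(m+2) distinct labels of total at
    most nq. Comparing twice this bound with n(m+2)(n(m+2)+1) and dividing by n leaves n(m^2-2) <=
    m-2, which is false for m >= 2. *)
Lemma exists_nonleaf_triangle : 2 <= m ->
  exists i, forall b, weight f (rim (i, b)) \notin leaf_colors.
Proof.
move=> m_ge2.
suff /existsP[i /forallP i_new] :
    [exists i, forall b, weight f (rim (i, b)) \notin leaf_colors].
  by exists i.
apply: contraLR isT => /existsPn all_leaf.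
(* [b i] selects a leaf-coloured rim vertex of triangle i: the [false] one if it qualifies, and the
   [true] one otherwise. *)
pose b i := weight f (rim (i, false)) \notin leaf_colors.
have sum_le : \sum_i weight f (rim (i, b i)) <= n * q.
  have -> : n * q = \sum_(i < n) q by rewrite sum_nat_const card_ord.
  apply: leq_sum => i _; apply: leaf_colors_le.
  have /forallPn[c] := all_leaf i; rewrite negbK /b.
  case: (boolP (weight f (rim (i, false)) \in leaf_colors)) => //= new.
  by case: c => // old; rewrite old in new.
pose h (x : 'I_n + 'I_n + 'I_n * 'I_m) : edge_index :=
  match x with
  | inl (inl i) => base i
  | inl (inr i) => spoke (i, b i)
  | inr (i, k) => pendant (Some (i, b i)) k
  end.
have h_inj : injective h.
  by move=> [[i|i]|[i k]] [[j|j]|[j l]] //= [->] // _ ->.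
have := leq_sum_inj_pos (inj_comp label_inj h_inj) (fun x => label_gt0 (h x)).
rewrite !big_sumType !card_sum !card_prod !card_ord /=.
(* The selected vertices lie in different triangles and share no edge, so the total is exact. *)
have -> : \sum_i g (base i) + \sum_i g (spoke (i, b i)) +
    \sum_ik g (h (inr ik)) = \sum_i weight f (rim (i, b i)).
  under [RHS]eq_bigr do rewrite weight_rim.
  rewrite !big_split /= pair_bigA /=; congr (_ + _).
  by apply: eq_bigr => -[i k].
rewrite /q in sum_le *; nia.
Qed.

End Weights.

(** * The lower bound for a single labeling *)

(** The hub colour exceeds every label, so no leaf has it. The hub and the rim vertices of one
    triangle are pairwise adjacent, so the new colours found there are distinct. *)
Lemma local_antimagic_leq_num_colors (f : labeling G) :
    2 <= n -> local_antimagic f ->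
  (2 <= m -> m * (2 * n + 1) + 3 <= num_colors f) /\
  (m = 1 -> m * (2 * n + 1) + 2 <= num_colors f).
Proof.
move=> n_ge2 /andP[f_bij /forallP f_adj].
have neq_w u v : adj u v -> weight f u != weight f v.
  by move: (f_adj u) => /forallP/(_ v)/implyP.
have hub_new : weight f hub \notin leaf_colors f.
  apply: contraL (weight_hub_gt f_bij n_ge2) => /leaf_colors_le.
  by rewrite -leqNgt.
have hub_neq p : weight f hub != weight f (rim p) by apply: neq_w.
split=> [m_ge2|m1].
  have [i i_new] := exists_nonleaf_triangle f_bij n_ge2 m_ge2.
  apply: (@leq_num_colors f f_bij [:: weight f hub; weight f (rim (i, false));
    weight f (rim (i, true))]).
  - by rewrite /= !inE negb_or !hub_neq neq_w //= eqxx.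
  - by apply/allP; rewrite /= hub_new !i_new.
  - by apply/allP; rewrite /= !map_f ?mem_enum.
have [p p_new] := exists_nonleaf_color f_bij n_ge2 m1.
apply: (@leq_num_colors f f_bij [:: weight f hub; weight f (rim p)]).
- by rewrite /= !inE hub_neq.
- by apply/allP; rewrite /= hub_new p_new.
- by apply/allP; rewrite /= !map_f ?mem_enum.
Qed.

(** * Construction of a local antimagic labeling *)

Lemma exists_edge_bijection (lab : edge_index -> nat) :
    injective lab -> (forall x, 0 < lab x <= #|edges G|) ->
  exists2 f : labeling G,
    edge_bijection f & forall x, f (edge_of x) = lab x :> nat.
Proof.
move=> lab_inj lab_range.
(* The value [ord0] is taken only on sets that are not edges; [inord] does not truncate since
   [lab x] is at most q. *)
pose f : labeling G :=
  [ffun e =>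
    if [pick x | edge_of x == e] is Some x then inord (lab x) else ord0].
have fE x : f (edge_of x) = lab x :> nat.
  rewrite ffunE; case: pickP => [y /eqP/edge_of_inj->|/(_ x)]; last first.
    by rewrite eqxx.
  by rewrite inordK // ltnS; case/andP: (lab_range x).
have f_inj : {in edges G &, injective f}.
  move=> _ _ /edgesP[x ->] /edgesP[y ->].
  by move/(congr1 val); rewrite /= !fE => /lab_inj->.
exists f => //; apply/andP; split; first exact/dinjectiveP.
(* Both sets have q elements, so one inclusion suffices. *)
rewrite eqEcard cardsC1 card_ord card_in_imset // leqnn andbT.
apply/subsetP => k /imsetP[_ /edgesP[x ->] ->].
by rewrite !inE -val_eqE /= fE -lt0n; case/andP: (lab_range x).
Qed.

(** The number [2 * i + b] ranks the rim vertices from 0. Each vertex receives a block of m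
    consecutive pendant labels, the hub block being last. *)
Definition increasing_label (x : edge_index) : nat :=
  match x with
  | inl (inl i) => i.+1
  | inl (inr (i, b)) => n + (2 * i + b).+1
  | inr (Some (i, b), k) => 3 * n + (2 * i + b) * m + k.+1
  | inr (None, k) => 3 * n + 2 * n * m + k.+1
  end.

Lemma increasing_label_inj : injective increasing_label.
Proof.
have rim_le (i : 'I_n) (b : bool) (k : 'I_m) : (2 * i + b) * m + k < 2 * n * m.
  have := ltn_ord i; have := ltn_ord k; case: b => /=; nia.
(* This is uniqueness of quotient and remainder modulo m. *)
have pair_inj a c (k l : 'I_m) : a * m + k = c * m + l -> a = c /\ k = l.
  have m_gt0 : 0 < m by apply: leq_ltn_trans (ltn_ord k).
  move=> e; have eq_ac : a = c.
    by move/(congr1 (divn^~ m)): e; rewrite !divnMDl // !divn_small // !addn0.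
  by split=> //; apply: val_inj; subst c; apply: addnI e.
have two_inj (i j : 'I_n) (b c : bool) :
    2 * i + b = 2 * j + c -> (i, b) = (j, c).
  case: b c => [] [] /= e; try lia; congr (_, _); apply: val_inj => /=; lia.
(* Base, spoke, rim pendant and hub pendant labels fill disjoint intervals, so the mixed cases are
   contradictory. *)
move=> [[i|[i b]]|[[[i b]|] k]] [[j|[j c]]|[[[j c]|] l]] /= e;
  try (have := ltn_ord i); try (have := ltn_ord j); try (have := rim_le i b k);
  try (have := rim_le j c l); move=> *; try by exfalso; lia.
- by congr (inl (inl _)); apply: val_inj => /=; lia.
- by have /two_inj[-> ->] : 2 * i + b = 2 * j + c by lia.
- have /pair_inj[/two_inj[-> ->] -> //] :
    (2 * i + b) * m + k = (2 * j + c) * m + l by lia.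
- by congr (inr (_, _)); apply: val_inj => /=; lia.
Qed.

(** Along every edge the weights compare strictly: a leaf lies below its neighbour, and in a
    triangle the [false] vertex lies below the [true] one, which lies below the hub. *)
Lemma exists_local_antimagic :
  0 < n -> exists f : labeling G, local_antimagic f.
Proof.
move=> n_gt0.
have [|f f_bij fE] := exists_edge_bijection increasing_label_inj.
  move=> x; rewrite card_edges.
  case: x => [[i|[i b]]|[[[i b]|] k]] /=.
  - by have := ltn_ord i; lia.
  - by have := ltn_ord i; case: b => /=; lia.
  - by have := ltn_ord i; have := ltn_ord k; case: b => /=; nia.
  - by have := ltn_ord k; lia.
pose lab := increasing_label.
have w_rim i b : weight f (rim (i, b)) =
    lab (base i) + lab (spoke (i, b)) + \sum_k lab (pendant (Some (i, b)) k).
  rewrite weight_rim; congr (_ + _ + _); try exact: fE.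
  by apply: eq_bigr => k _; apply: fE.
have w_hub : weight f hub =
    \sum_p lab (spoke p) + \sum_k lab (pendant None k).
  by rewrite weight_hub; congr (_ + _); apply: eq_bigr => x _; apply: fE.
have w_leaf v k : weight f (leaf v k) = lab (pendant v k).
  by rewrite weight_leaf; apply: fE.
have lt_rim i : weight f (rim (i, false)) < weight f (rim (i, true)).
  rewrite !w_rim -addSn leq_add //=; first by lia.
  by apply: leq_sum => k _; nia.
have lt_hub i b : weight f (rim (i, b)) < weight f hub.
  rewrite w_rim w_hub -addSn leq_add //.
    (* Two spokes suffice here: the one at (i, b) cancels, and the other one of triangle i has a
       label above n, hence above that of the base edge. *)
    rewrite (bigD1 (i, b)) //= (bigD1 (i, ~~ b)) /=; last first.
      by rewrite xpair_eqE eqxx; case: (b).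
    by have := ltn_ord i; lia.
  apply: leq_sum => k _ /=.
  by have := ltn_ord i; case: (b) => /=; nia.
have lt_leaf v k : weight f (leaf v k) < weight f (inl v).
  have le_sum : lab (pendant v k) <= \sum_l lab (pendant v l).
    by rewrite (bigD1 k) // leq_addr.
  rewrite w_leaf; case: v le_sum => [[i b]|] le_sum.
    by rewrite (w_rim i b) /= in le_sum *; lia.
  (* Any spoke, here that of triangle 0, makes the inequality strict. *)
  by rewrite w_hub (bigD1 (Ordinal n_gt0, false)) //= in le_sum *; lia.
exists f; rewrite /local_antimagic f_bij; apply/forallP => u.
apply/forallP => v; apply/implyP.
case: u v => [[[i a]|]|[u k]] [[[j b]|]|[v l]] //=.
- by move=> /andP[/eqP<-]; case: a b => [] [] // _;
    rewrite neq_ltn lt_rim ?orbT.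
- by rewrite neq_ltn lt_hub.
- by move/eqP->; rewrite neq_ltn lt_leaf orbT.
- by rewrite neq_ltn lt_hub orbT.
- by move/eqP->; rewrite neq_ltn lt_leaf orbT.
- by move/eqP<-; rewrite neq_ltn lt_leaf.
- by move/eqP<-; rewrite neq_ltn lt_leaf.
- by rewrite /null_adj andbF.
Qed.

End FriendshipCorona.

(** * Passage to the minimum over all labelings *)

Theorem lemma2p1 (n m : nat) (hn : 2 <= n) (hm : 1 <= m) :
  (2 <= m ->
     m * (2 * n + 1) + 3 <= chi_la (corona (friendship n) (null_graph m))) /\
  (m = 1 ->
     m * (2 * n + 1) + 2 <= chi_la (corona (friendship n) (null_graph m)) /\
     m * (2 * n + 1) + 2 = 2 * n + 3).
Proof.
have [f0 f0_la] := exists_local_antimagic m (ltnW hn).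
(* Existence of [f0] excludes the default value 0, so [chi_la] is the number of colours of some
   labeling [f]. *)
have [[f f_la <-] _] := chi_laP f0_la.
have [bound2 bound1] := local_antimagic_leq_num_colors hn f_la.
by split=> // m1; split; [apply: bound1 | lia].
Qed.
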